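(* The class of completely representable polyadic algebras of dimension $2$ is elementary; that is, there is a set $\Sigma$ of first-order sentences in the language of $\mathbf{PA}_2$ whose models are exactly the completely representable algebras in $\mathbf{PA}_2$.
   Context: For an ordinal $\alpha$, $\mathbf{PA}_\alpha$ is the class of ((quasi-)polyadic, finitary) polyadic algebras without equality of dimension $\alpha$: algebras $\mathfrak{A}=(A,+,\cdot,-,0,1,\mathsf{c}_i,\mathsf{s}^i_j,\mathsf{s}_{[i,j]})_{i,j<\alpha}$ such that $(A,+,\cdot,-,0,1)$ is a Boolean algebra and, for all $i,j,k<\alpha$ and $x,y\in A$: $\mathsf{s}^i_i x=\mathsf{s}_{[i,i]}x=x$, $\mathsf{s}_{[i,j]}=\mathsf{s}_{[j,i]}$; $x\le \mathsf{c}_i x$; $\mathsf{c}_i(x+y)=\mathsf{c}_ix+\mathsf{c}_iy$; $\mathsf{s}^i_j\mathsf{c}_ix=\mathsf{c}_ix$; $\mathsf{c}_i\mathsf{s}^i_jx=\mathsf{s}^i_jx$ if $i\ne j$; $\mathsf{s}^i_j\mathsf{c}_kx=\mathsf{c}_k\mathsf{s}^i_jx$ if $k\notin\{i,j\}$; $\mathsf{s}^i_j$ and $\mathsf{s}_{[i,j]}$ are Boolean endomorphisms; $\mathsf{s}_{[i,j]}\mathsf{s}_{[i,j]}x=x$; $\mathsf{s}_{[i,j]}\mathsf{s}_{[i,k]}x=\mathsf{s}_{[j,k]}\mathsf{s}_{[i,j]}x$ for distinct $i,j,k$; $\mathsf{s}_{[i,j]}\mathsf{s}^i_jx=\mathsf{s}^j_ix$.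 For finite $n$ and a set $U$, the full polyadic set algebra on $U$ is $\wp({}^nU)$ with the Boolean set operations, $\mathsf{c}_iX=\{s\in{}^nU:\exists t\in X,\ t(j)=s(j)\text{ for all }j\ne i\}$, $\mathsf{s}^i_jX=\{s: s\circ[i|j]\in X\}$ and $\mathsf{s}_{[i,j]}X=\{s: s\circ[i,j]\in X\}$, where $[i|j]:n\to n$ sends $i$ to $j$ and fixes everything else and $[i,j]$ is the transposition of $i$ and $j$. A representation of $\mathfrak{A}\in\mathbf{PA}_n$ is an injective homomorphism $h$ from $\mathfrak{A}$ into a direct product $\prod_{k\in K}\wp({}^nU_k)$ of full polyadic set algebras; it is complete if it preserves all existing suprema, i.e. $h(\sum S)=\sup h[S]$ (computed as coordinatewise union) whenever $S\subseteq A$ and $\sum S$ exists in $\mathfrak{A}$. $\mathfrak{A}$ is completely representable if it has a complete representation. *)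

(* Defs.v *)
From mathcomp Require Import all_boot fingroup perm.
From mathcomp Require Import boolp classical_sets.

Set Implicit Arguments.
Unset Strict Implicit.
Unset Printing Implicit Defensive.

Local Open Scope classical_set_scope.

(* Arbitrary first-order structures for the language of PA_n: no axioms yet. *)
Record pa_structure (n : nat) := PaStructure {
  carrier :> Type;
  pa_join : carrier -> carrier -> carrier;
  pa_meet : carrier -> carrier -> carrier;
  pa_compl : carrier -> carrier;
  pa_zero : carrier;
  pa_one : carrier;
  pa_cyl : 'I_n -> carrier -> carrier;               (* c_i *)
  pa_subst : 'I_n -> 'I_n -> carrier -> carrier;     (* pa_subst i j = s^i_j *)
  pa_transp : 'I_n -> 'I_n -> carrier -> carrier     (* s_[i,j] *)
}.

Arguments pa_zero {n} p.
Arguments pa_one {n} p.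

Definition pa_le n (A : pa_structure n) (x y : A) : Prop := pa_join x y = y.

(* The one-element Boolean algebra (0 = 1) is allowed. *)
Record is_boolean_algebra n (A : pa_structure n) : Prop := IsBooleanAlgebra {
  ba_joinC : forall x y : A, pa_join x y = pa_join y x;
  ba_meetC : forall x y : A, pa_meet x y = pa_meet y x;
  ba_joinA : forall x y z : A,
    pa_join x (pa_join y z) = pa_join (pa_join x y) z;
  ba_meetA : forall x y z : A,
    pa_meet x (pa_meet y z) = pa_meet (pa_meet x y) z;
  ba_joinK : forall x y : A, pa_join x (pa_meet x y) = x;
  ba_meetK : forall x y : A, pa_meet x (pa_join x y) = x;
  ba_meet_join : forall x y z : A,
    pa_meet x (pa_join y z) = pa_join (pa_meet x y) (pa_meet x z);
  ba_join_meet : forall x y z : A,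
    pa_join x (pa_meet y z) = pa_meet (pa_join x y) (pa_join x z);
  ba_join0 : forall x : A, pa_join x (pa_zero A) = x;
  ba_meet1 : forall x : A, pa_meet x (pa_one A) = x;
  ba_join_compl : forall x : A, pa_join x (pa_compl x) = pa_one A;
  ba_meet_compl : forall x : A, pa_meet x (pa_compl x) = pa_zero A
}.

Record is_boolean_hom n (A B : pa_structure n) (f : A -> B) : Prop :=
  IsBooleanHom {
  hom_join : forall x y : A, f (pa_join x y) = pa_join (f x) (f y);
  hom_meet : forall x y : A, f (pa_meet x y) = pa_meet (f x) (f y);
  hom_compl : forall x : A, f (pa_compl x) = pa_compl (f x);
  hom_zero : f (pa_zero A) = pa_zero B;
  hom_one : f (pa_one A) = pa_one B
}.

Record is_PA n (A : pa_structure n) : Prop := IsPA {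
  PA_boolean : is_boolean_algebra A;
  PA_subst_id : forall (i : 'I_n) (x : A), pa_subst i i x = x;
  PA_transp_id : forall (i : 'I_n) (x : A), pa_transp i i x = x;
  PA_transpC : forall (i j : 'I_n) (x : A), pa_transp i j x = pa_transp j i x;
  PA_le_cyl : forall (i : 'I_n) (x : A), pa_le x (pa_cyl i x);
  PA_cyl_join : forall (i : 'I_n) (x y : A),
    pa_cyl i (pa_join x y) = pa_join (pa_cyl i x) (pa_cyl i y);
  PA_subst_cyl : forall (i j : 'I_n) (x : A),
    pa_subst i j (pa_cyl i x) = pa_cyl i x;
  PA_cyl_subst : forall (i j : 'I_n) (x : A), i <> j ->
    pa_cyl i (pa_subst i j x) = pa_subst i j x;
  PA_subst_cylC : forall (i j k : 'I_n) (x : A), k <> i -> k <> j ->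
    pa_subst i j (pa_cyl k x) = pa_cyl k (pa_subst i j x);
  PA_subst_hom : forall i j : 'I_n, is_boolean_hom (@pa_subst n A i j);
  PA_transp_hom : forall i j : 'I_n, is_boolean_hom (@pa_transp n A i j);
  PA_transpK : forall (i j : 'I_n) (x : A),
    pa_transp i j (pa_transp i j x) = x;
  PA_transp_transp : forall (i j k : 'I_n) (x : A),
    i <> j -> i <> k -> j <> k ->
    pa_transp i j (pa_transp i k x) = pa_transp j k (pa_transp i j x);
  PA_transp_subst : forall (i j : 'I_n) (x : A),
    pa_transp i j (pa_subst i j x) = pa_subst j i x
}.

(* The map [i|j]. *)
Definition replacement n (i j : 'I_n) : 'I_n -> 'I_n :=
  fun k => if k == i then j else k.

Definition full_set_algebra (n : nat) (U : Type) : pa_structure n :=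
  {| carrier := set ('I_n -> U);
     pa_join := @setU _;
     pa_meet := @setI _;
     pa_compl := @setC _;
     pa_zero := set0;
     pa_one := setT;
     pa_cyl := fun i X =>
       [set s : 'I_n -> U | exists2 t, X t & forall j, j <> i -> t j = s j];
     pa_subst := fun i j X => [set s : 'I_n -> U | X (s \o replacement i j)];
     pa_transp := fun i j X => [set s : 'I_n -> U | X (s \o tperm i j)] |}.

Definition product_structure (n : nat) (K : Type) (A : K -> pa_structure n) :
  pa_structure n :=
  {| carrier := forall k, A k;
     pa_join := fun x y k => pa_join (x k) (y k);
     pa_meet := fun x y k => pa_meet (x k) (y k);
     pa_compl := fun x k => pa_compl (x k);
     pa_zero := fun k => pa_zero (A k);
     pa_one := fun k => pa_one (A k);
     pa_cyl := fun i x k => pa_cyl i (x k);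
     pa_subst := fun i j x k => pa_subst i j (x k);
     pa_transp := fun i j x k => pa_transp i j (x k) |}.

Record is_homomorphism n (A B : pa_structure n) (f : A -> B) : Prop :=
  IsHomomorphism {
  hom_boolean : is_boolean_hom f;
  hom_cyl : forall (i : 'I_n) (x : A), f (pa_cyl i x) = pa_cyl i (f x);
  hom_subst : forall (i j : 'I_n) (x : A),
    f (pa_subst i j x) = pa_subst i j (f x);
  hom_transp : forall (i j : 'I_n) (x : A),
    f (pa_transp i j x) = pa_transp i j (f x)
}.

Definition is_representation n (A : pa_structure n) (K : Type) (U : K -> Type)
    (h : A -> product_structure (fun k => full_set_algebra n (U k))) : Prop :=
  is_homomorphism h /\ injective h.

Definition is_supremum n (A : pa_structure n) (S : set A) (x : A) : Prop :=
  (forall a, S a -> pa_le a x) /\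
  (forall y, (forall a, S a -> pa_le a y) -> pa_le x y).

Definition is_complete_representation n (A : pa_structure n)
    (K : Type) (U : K -> Type)
    (h : A -> product_structure (fun k => full_set_algebra n (U k))) : Prop :=
  is_representation h /\
  forall (S : set A) (x : A), is_supremum S x ->
    forall k : K, h x k = \bigcup_(a in S) (h a k : set ('I_n -> U k)).

Definition completely_representable n (A : pa_structure n) : Prop :=
  exists (K : Type) (U : K -> Type)
    (h : A -> product_structure (fun k => full_set_algebra n (U k))),
    is_complete_representation h.

(* First-order logic with equality over the language of PA_n; variables are
   named by natural numbers. *)
Inductive pa_term (n : nat) : Type :=
| TVar (x : nat)
| TZero
| TOne
| TJoin (t u : pa_term n)
| TMeet (t u : pa_term n)
| TCompl (t : pa_term n)
| TCyl (i : 'I_n) (t : pa_term n)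
| TSubst (i j : 'I_n) (t : pa_term n)
| TTransp (i j : 'I_n) (t : pa_term n).

Inductive pa_formula (n : nat) : Type :=
| FEq (t u : pa_term n)
| FNot (p : pa_formula n)
| FAnd (p q : pa_formula n)
| FOr (p q : pa_formula n)
| FImp (p q : pa_formula n)
| FAll (x : nat) (p : pa_formula n)
| FEx (x : nat) (p : pa_formula n).

Fixpoint term_var n (x : nat) (t : pa_term n) : bool :=
  match t with
  | TVar y => x == y
  | TZero | TOne => false
  | TJoin t u | TMeet t u => term_var x t || term_var x u
  | TCompl t | TCyl _ t | TSubst _ _ t | TTransp _ _ t => term_var x t
  end.

Fixpoint free_var n (x : nat) (p : pa_formula n) : bool :=
  match p with
  | FEq t u => term_var x t || term_var x u
  | FNot p => free_var x p
  | FAnd p q | FOr p q | FImp p q => free_var x p || free_var x q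
  | FAll y p | FEx y p => (x != y) && free_var x p
  end.

Definition is_sentence n (p : pa_formula n) : Prop :=
  forall x : nat, ~~ free_var x p.

Fixpoint eval n (A : pa_structure n) (v : nat -> A) (t : pa_term n) : A :=
  match t with
  | TVar x => v x
  | TZero => pa_zero A
  | TOne => pa_one A
  | TJoin t u => pa_join (eval v t) (eval v u)
  | TMeet t u => pa_meet (eval v t) (eval v u)
  | TCompl t => pa_compl (eval v t)
  | TCyl i t => pa_cyl i (eval v t)
  | TSubst i j t => pa_subst i j (eval v t)
  | TTransp i j t => pa_transp i j (eval v t)
  end.

Definition update (T : Type) (v : nat -> T) (x : nat) (a : T) : nat -> T :=
  fun y => if y == x then a else v y.

Fixpoint satisfies n (A : pa_structure n) (v : nat -> A) (p : pa_formula n) :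
  Prop :=
  match p with
  | FEq t u => eval v t = eval v u
  | FNot p => ~ satisfies v p
  | FAnd p q => satisfies v p /\ satisfies v q
  | FOr p q => satisfies v p \/ satisfies v q
  | FImp p q => satisfies v p -> satisfies v q
  | FAll x p => forall a : A, satisfies (update v x a) p
  | FEx x p => exists a : A, satisfies (update v x a) p
  end.

(* Every structure is nonempty, and the truth of a sentence does not depend on
   the valuation. *)
Definition is_model n (A : pa_structure n) (Sigma : set (pa_formula n)) :
  Prop :=
  forall p, Sigma p -> forall v : nat -> A, satisfies v p.

Definition elementary n (C : pa_structure n -> Prop) : Prop :=
  exists Sigma : set (pa_formula n),
    (forall p, Sigma p -> is_sentence p) /\
    (forall A : pa_structure n, is_model A Sigma <-> C A).

(* Main.v *)
From mathcomp Require Import all_boot fingroup perm.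
From mathcomp Require Import boolp classical_sets wochoice.
Require Import Defs.

(** The class is axiomatized by the identities of polyadic algebras, two more
    identities valid in all set algebras, and, for each pair [i], [j], a
    sentence saying that every nonzero [y] meets [s^i_j a] for some atom [a].

    Soundness ([rep_cr_laws]). Under a complete representation the elements
    containing a given point form an ultrafilter. It has an atom, since
    otherwise the complements of its members would have supremum 1 while no
    image of such a complement contains the point ([rep_atom]). For a point [s]
    in the image of [y], the atom of [s \o replacement i j] is then as
    required.

    Completeness in dimension 2 ([cr_laws_completely_representable]). The
    covering sentences give each atom [b] a unique atom [a] with
    [b <= s^i_j a], its shadow. Think of an atom as the isomorphism type of a
    pair [(s0, s1)]: its two shadows are the types of [(s1, s1)] and [(s0, s0)],
    and [s_[0,1]] turns it into the type of [(s1, s0)]. The atoms therefore are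
    the edges of a directed graph with a reversal, whose vertices are
    represented by the shadows; two atoms lie under the same cylinders in
    direction 0 exactly when they have the same target ([below_cyl]), and
    commutation of the cylindrifications makes the relation of being joined by
    an edge transitive ([atom_graph]).

    A representation amounts to a set of points and a labelling of all pairs of
    points by edges, compatible with targets and reversal, in which each edge
    into the vertex of [v] is the label of some pair [(u, v)]. Two points may
    carry the same vertex, and in dimension 2 no condition links the labels of
    three pairs other than through their endpoints, so the labelling can be
    written down at once: points are lists of edges of one component, the pair
    [(c :: v, v)] is labelled [c] whenever [c] ends at the vertex of [v], and all
    other pairs are labelled by choice ([exists_saturated_labelling]). One such
    labelling for each atom makes the representation injective; it preserves
    suprema because an atom below a supremum is below one of the elements. *)

Set Implicit Arguments.
Unset Strict Implicit.
Unset Printing Implicit Defensive.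

Local Open Scope classical_set_scope.

(** * Boolean algebra and atoms *)

Section BooleanAlgebra.
Variables (n : nat) (A : pa_structure n).
Hypothesis BA : is_boolean_algebra A.
Implicit Types x y z a b : A.

Lemma le_refl x : pa_le x x.
Proof. by rewrite /pa_le -{2}(ba_meetK BA x x) (ba_joinK BA). Qed.

Lemma le_trans x y z : pa_le x y -> pa_le y z -> pa_le x z.
Proof. by rewrite /pa_le => xy <-; rewrite (ba_joinA BA) xy. Qed.

Lemma le_anti x y : pa_le x y -> pa_le y x -> x = y.
Proof. by rewrite /pa_le => xy yx; rewrite -xy (ba_joinC BA) yx. Qed.

Lemma le_joinl x y : pa_le x (pa_join x y).
Proof. by rewrite /pa_le (ba_joinA BA) (le_refl x). Qed.

Lemma le_joinr x y : pa_le y (pa_join x y).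
Proof. by rewrite (ba_joinC BA); apply: le_joinl. Qed.

Lemma le_meetl x y : pa_le (pa_meet x y) x.
Proof. by rewrite /pa_le (ba_joinC BA) (ba_joinK BA). Qed.

Lemma le_meetr x y : pa_le (pa_meet x y) y.
Proof. by rewrite (ba_meetC BA); apply: le_meetl. Qed.

Lemma le_meetP z x y : pa_le z (pa_meet x y) <-> pa_le z x /\ pa_le z y.
Proof.
split=> [zxy|[]]; first by split; apply: le_trans zxy _;
  [apply: le_meetl|apply: le_meetr].
by rewrite /pa_le (ba_join_meet BA) => -> ->.
Qed.

Lemma le_meet_eq x y : pa_le x y -> pa_meet x y = x.
Proof. by rewrite /pa_le => <-; apply: (ba_meetK BA). Qed.

Lemma le0 x : pa_le (pa_zero A) x.
Proof. by rewrite /pa_le (ba_joinC BA) (ba_join0 BA). Qed.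

Lemma le1 x : pa_le x (pa_one A).
Proof. by rewrite -(ba_meet1 BA x); apply: le_meetr. Qed.

Lemma le0_eq x : pa_le x (pa_zero A) -> x = pa_zero A.
Proof. by move=> x0; apply: le_anti x0 (le0 x). Qed.

Lemma le_disjoint x y : pa_le x y -> pa_le x (pa_compl y) -> x = pa_zero A.
Proof.
by move=> xy xy'; apply: le0_eq; rewrite -(ba_meet_compl BA y); apply/le_meetP.
Qed.

Lemma meet0_le_compl x y : pa_meet x y = pa_zero A -> pa_le x (pa_compl y).
Proof.
move=> xy0; rewrite -(ba_meet1 BA x) -(ba_join_compl BA y) (ba_meet_join BA) xy0.
by rewrite (ba_joinC BA) (ba_join0 BA); apply: le_meetr.
Qed.

Lemma meet_compl0_le x y : pa_meet x (pa_compl y) = pa_zero A -> pa_le x y.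
Proof.
move=> xy0; rewrite -(ba_meet1 BA x) -(ba_join_compl BA y) (ba_meet_join BA) xy0.
by rewrite (ba_join0 BA); apply: le_meetr.
Qed.

Lemma le_compl_meet0 x y : pa_le x (pa_compl y) -> pa_meet x y = pa_zero A.
Proof.
move=> xy; apply: (@le_disjoint _ y); first exact: le_meetr.
by apply: le_trans xy; apply: le_meetl.
Qed.

Lemma le_complC x y : pa_le x (pa_compl y) -> pa_le y (pa_compl x).
Proof. by move=> /le_compl_meet0 xy; apply: meet0_le_compl; rewrite (ba_meetC BA). Qed.

Lemma compl_leC x y : pa_le (pa_compl x) y -> pa_le (pa_compl y) x.
Proof.
move=> xy; apply: meet_compl0_le; rewrite (ba_meetC BA).
apply: (@le_disjoint _ y); last exact: le_meetr.
by apply: le_trans xy; apply: le_meetl.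
Qed.

(** Deciding every element below or off [a] is the form of atomicity that a
    first-order formula and the ultrafilter of a point both provide directly. *)
Definition is_atom a :=
  a <> pa_zero A /\ forall x, pa_le a x \/ pa_le a (pa_compl x).

Lemma atom_le_compl a x : is_atom a -> pa_le a (pa_compl x) <-> ~ pa_le a x.
Proof.
move=> [a0 a_dec]; split=> [ax' ax|nax]; first exact: a0 (le_disjoint ax ax').
by case: (a_dec x).
Qed.

Lemma atom_meet a x : is_atom a -> pa_meet x a <> pa_zero A -> pa_le a x.
Proof.
move=> [a0 a_dec] xa0; case: (a_dec x) => // ax'.
by case: xa0; rewrite (ba_meetC BA); apply: le_compl_meet0.
Qed.

Lemma atom_le_join a x y :
  is_atom a -> pa_le a (pa_join x y) <-> pa_le a x \/ pa_le a y.
Proof.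
move=> a_at; split=> [axy|[ax|ay]]; last 2 first.
- exact: le_trans ax (le_joinl x y).
- exact: le_trans ay (le_joinr x y).
case: (a_at) => a0 a_dec; case: (a_dec x) => [|ax']; [by left|right].
move: (le_meet_eq axy); rewrite (ba_meet_join BA) (le_compl_meet0 ax').
by rewrite (ba_joinC BA) (ba_join0 BA) => <-; apply: le_meetr.
Qed.

Lemma atom_le_eq a b : is_atom a -> is_atom b -> pa_le a b -> a = b.
Proof.
move=> [a0 _] [_ b_dec] ab; apply: le_anti (ab) _.
case: (b_dec a) => // ba'; case: a0.
by apply: le_disjoint (le_refl a) _; apply: le_trans ba'.
Qed.

(** Otherwise [compl a] would be a smaller upper bound. *)
Lemma atom_le_sup a (S : set A) x :
  is_atom a -> is_supremum S x -> pa_le a x -> exists2 s, S s & pa_le a s.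
Proof.
move=> a_at [_ x_least] ax; apply: contrapT => none.
case: (a_at) => a0 _; apply: a0; apply: le_disjoint ax _.
apply: le_complC; apply: x_least => s Ss; apply: le_complC.
by apply/(atom_le_compl _ a_at) => as_; apply: none; exists s.
Qed.

End BooleanAlgebra.

Lemma hom_le n (A B : pa_structure n) (f : A -> B) x y :
  is_boolean_hom f -> pa_le x y -> pa_le (f x) (f y).
Proof. by move=> fhom; rewrite /pa_le -(hom_join fhom) => ->. Qed.

(** * Labelling pairs of points by the edges of a reversible graph *)

(** A graph given by its edges alone: the vertex an edge ends at is encoded as a
    distinguished loop [tgt e] there, and the vertex it starts from is
    [tgt (rev e)]. *)
Record reversible_graph (E : Type) (tgt rev : E -> E) : Prop := ReversibleGraph {
  revK : forall e, rev (rev e) = e;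
  tgt_tgt : forall e, tgt (tgt e) = tgt e;
  rev_tgt : forall e, rev (tgt e) = tgt e;
  graph_comp : forall a b, tgt a = tgt b ->
    exists2 c, tgt (rev c) = tgt (rev a) & tgt c = tgt (rev b)
}.

(** By [lab_tgt] the label of the diagonal pair [(v, v)] is the vertex carried
    by [v]. *)
Record saturated_labelling (E : Type) (tgt rev : E -> E)
    (U : Type) (l : U -> U -> E) : Prop := SaturatedLabelling {
  lab_tgt : forall u v, tgt (l u v) = l v v;
  lab_rev : forall u v, rev (l u v) = l v u;
  lab_sat : forall v e, tgt e = l v v -> exists u, l u v = e
}.

Lemma exists_orientation (U : Type) :
  exists R : U -> U -> Prop, forall u v, u <> v -> (R u v <-> ~ R v u).
Proof.
have [R Rwo] := well_ordering_principle {classic U}.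
have Rchain : @wo_chain {classic U} R predT by apply: withinW.
exists (fun u v => R u v) => u v uv; split=> [Ruv Rvu|nRvu].
  by apply: uv; apply: (wo_chain_antisymmetric Rchain); rewrite ?inE // Ruv Rvu.
by have /orP[] // := wo_chainW Rchain (isT : u \in predT) (isT : v \in predT).
Qed.

Section GraphLabelling.
Variables (E : Type) (tgt rev : E -> E).
Hypothesis G : reversible_graph tgt rev.

Local Notation src e := (tgt (rev e)).

Definition linked x y := exists2 e, src e = x & tgt e = y.

Lemma linked_sym x y : linked x y -> linked y x.
Proof. by case=> e <- <-; exists (rev e); rewrite ?(revK G). Qed.

Lemma linked_trans x y z : linked x y -> linked y z -> linked x z.
Proof.
case=> a <- <- [b ab <-].
have [|c <- cb] := graph_comp G (a := a) (b := rev b); first by rewrite ab.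
by exists c; rewrite // cb (revK G).
Qed.

Lemma linked_refl e : linked (tgt e) (tgt e).
Proof. by exists (tgt e); rewrite ?(rev_tgt G) (tgt_tgt G). Qed.

Variable root : E.

(** Any two points must be joined by an edge, so only vertices linked to that
    of [root] can be used. *)
Definition component := {e : E | linked (src e) (tgt root)}.

Definition point := seq component.

Definition ptype (w : point) : E :=
  if w is c :: _ then src (proj1_sig c) else tgt root.

Lemma linked_root w : linked (ptype w) (tgt root).
Proof. by case: w => [|[c cP] w] /=; first exact: linked_refl. Qed.

Lemma tgt_ptype w : tgt (ptype w) = ptype w.
Proof. by case: w => [|c w] /=; rewrite (tgt_tgt G). Qed.

Lemma rev_ptype w : rev (ptype w) = ptype w.
Proof. by case: w => [|c w] /=; rewrite (rev_tgt G). Qed.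

(** The point [c :: v] exists in order to be joined to [v] by the edge [c].
    Consecutive entries of a list need not be consecutive edges, so this forces
    the label only if [c] ends at the vertex of [v]. *)
Definition respects_witness (u v : point) e :=
  forall c, u = c :: v -> tgt (proj1_sig c) = ptype v -> e = proj1_sig c.

Record admissible (u v : point) e : Prop := Admissible {
  adm_src : src e = ptype u;
  adm_tgt : tgt e = ptype v;
  adm_diag : u = v -> e = ptype u;
  adm_wit : respects_witness u v e;
  adm_rev_wit : respects_witness v u (rev e)
}.

Lemma admissible_rev u v e : admissible u v e -> admissible v u (rev e).
Proof.
case=> es et ed ew erw; split=> //; rewrite ?(revK G) //.
by move=> vu; rewrite ed // vu rev_ptype.
Qed.

Lemma neq_cons_cat (T : Type) (c : T) s w : w <> c :: s ++ w.
Proof.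
by move=> /(congr1 size)/eqP; rewrite /= size_cat -addSn -{1}[size w]add0n eqn_add2r.
Qed.

Lemma exists_admissible_witness c v :
  tgt (proj1_sig c) = ptype v -> admissible (c :: v) v (proj1_sig c).
Proof.
move=> cv; split=> //.
- by move=> /esym/(@neq_cons_cat _ c [::]).
- by move=> d [->].
- by move=> d /(@neq_cons_cat _ d [:: c]).
Qed.

(** The constraints never compete: a pair cannot be both diagonal and of the
    form [(c :: v, v)], nor of that form in both orders. *)
Lemma exists_admissible u v : exists e, admissible u v e.
Proof.
have [<-|uv] := pselect (u = v).
  exists (ptype u); split=> //; rewrite ?rev_ptype ?tgt_ptype //.
  - by move=> c /(@neq_cons_cat _ c [::]).
  - by move=> c /(@neq_cons_cat _ c [::]).
have [[c [uc cv]]|nu] := pselect (exists c, u = c :: v /\ tgt (proj1_sig c) = ptype v).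
  by exists (proj1_sig c); rewrite uc; apply: exists_admissible_witness.
have [[c [vc cu]]|nv] := pselect (exists c, v = c :: u /\ tgt (proj1_sig c) = ptype u).
  exists (rev (proj1_sig c)); apply: admissible_rev; rewrite vc.
  exact: exists_admissible_witness.
have [e eu ev] := linked_trans (linked_root u) (linked_sym (linked_root v)).
exists e; split=> // c wc cP.
- by case: nu; exists c.
- by case: nv; exists c.
Qed.

(** Every ordered pair has an admissible edge, so it remains to make the choices
    for [(u, v)] and [(v, u)] mutually reverse: an orientation of the pairs
    decides which of the two choices is kept. *)
Lemma exists_saturated_labelling :
  exists (U : Type) (l : U -> U -> E),
    saturated_labelling tgt rev l /\ exists v, l v v = tgt root.
Proof.
exists point.
have [R RP] := exists_orientation point.
have [g gP] := choice (fun uv : point * point => exists_admissible uv.1 uv.2).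
pose l u v := if pselect (R u v) then g (u, v) else rev (g (v, u)).
have lP u v : admissible u v (l u v).
  rewrite /l; case: (pselect (R u v)) => /= Ruv; first exact: (gP (u, v)).
  exact: admissible_rev (gP (v, u)).
have ll v : l v v = ptype v by apply: adm_diag (lP v v) _.
exists l; split; last by exists [::]; rewrite ll.
split=> [u v|u v|v e].
- by rewrite ll (adm_tgt (lP u v)).
- have [->|uv] := pselect (u = v); first by rewrite ll rev_ptype.
  rewrite /l; case: (pselect (R u v)) => /= Ruv; case: (pselect (R v u)) => /= Rvu //.
  + by case/(RP _ _ uv): Ruv.
  + by rewrite (revK G).
  + by case: Ruv; apply/(RP _ _ uv).
- rewrite ll => ev.
  have e_root : linked (src e) (tgt root).
    by apply: linked_trans (linked_root v); exists e.
  exists (exist _ e e_root :: v).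
  exact: (adm_wit (lP _ v) (c := exist _ e e_root)).
Qed.

End GraphLabelling.

(** * The axioms *)

Section Axiomatization.
Variable n : nat.

Local Notation x := (TVar n 0).
Local Notation y := (TVar n 1).
Local Notation z := (TVar n 2).

Inductive pa_identity : pa_term n -> pa_term n -> Prop :=
| Id_joinC : pa_identity (TJoin x y) (TJoin y x)
| Id_meetC : pa_identity (TMeet x y) (TMeet y x)
| Id_joinA : pa_identity (TJoin x (TJoin y z)) (TJoin (TJoin x y) z)
| Id_meetA : pa_identity (TMeet x (TMeet y z)) (TMeet (TMeet x y) z)
| Id_joinK : pa_identity (TJoin x (TMeet x y)) x
| Id_meetK : pa_identity (TMeet x (TJoin x y)) x
| Id_meet_join :
    pa_identity (TMeet x (TJoin y z)) (TJoin (TMeet x y) (TMeet x z))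
| Id_join_meet :
    pa_identity (TJoin x (TMeet y z)) (TMeet (TJoin x y) (TJoin x z))
| Id_join0 : pa_identity (TJoin x (TZero n)) x
| Id_meet1 : pa_identity (TMeet x (TOne n)) x
| Id_join_compl : pa_identity (TJoin x (TCompl x)) (TOne n)
| Id_meet_compl : pa_identity (TMeet x (TCompl x)) (TZero n)
| Id_subst_id i : pa_identity (TSubst i i x) x
| Id_transp_id i : pa_identity (TTransp i i x) x
| Id_transpC i j : pa_identity (TTransp i j x) (TTransp j i x)
| Id_le_cyl i : pa_identity (TJoin x (TCyl i x)) (TCyl i x)
| Id_cyl_join i :
    pa_identity (TCyl i (TJoin x y)) (TJoin (TCyl i x) (TCyl i y))
| Id_subst_cyl i j : pa_identity (TSubst i j (TCyl i x)) (TCyl i x)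
| Id_cyl_subst i j : i <> j ->
    pa_identity (TCyl i (TSubst i j x)) (TSubst i j x)
| Id_subst_cylC i j k : k <> i -> k <> j ->
    pa_identity (TSubst i j (TCyl k x)) (TCyl k (TSubst i j x))
| Id_subst_join i j :
    pa_identity (TSubst i j (TJoin x y)) (TJoin (TSubst i j x) (TSubst i j y))
| Id_subst_meet i j :
    pa_identity (TSubst i j (TMeet x y)) (TMeet (TSubst i j x) (TSubst i j y))
| Id_subst_compl i j :
    pa_identity (TSubst i j (TCompl x)) (TCompl (TSubst i j x))
| Id_subst_zero i j : pa_identity (TSubst i j (TZero n)) (TZero n)
| Id_subst_one i j : pa_identity (TSubst i j (TOne n)) (TOne n)
| Id_transp_join i j : pa_identity (TTransp i j (TJoin x y))
    (TJoin (TTransp i j x) (TTransp i j y))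
| Id_transp_meet i j : pa_identity (TTransp i j (TMeet x y))
    (TMeet (TTransp i j x) (TTransp i j y))
| Id_transp_compl i j :
    pa_identity (TTransp i j (TCompl x)) (TCompl (TTransp i j x))
| Id_transp_zero i j : pa_identity (TTransp i j (TZero n)) (TZero n)
| Id_transp_one i j : pa_identity (TTransp i j (TOne n)) (TOne n)
| Id_transpK i j : pa_identity (TTransp i j (TTransp i j x)) x
| Id_transp_transp i j k : i <> j -> i <> k -> j <> k ->
    pa_identity (TTransp i j (TTransp i k x)) (TTransp j k (TTransp i j x))
| Id_transp_subst i j : pa_identity (TTransp i j (TSubst i j x)) (TSubst j i x).

(** Both hold in every full set algebra, the first because [replacement i j]
    does not distinguish its argument [i] from [j]. *)
Inductive set_identity : pa_term n -> pa_term n -> Prop :=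
| Id_subst_transp i j :
    set_identity (TSubst i j (TTransp i j x)) (TSubst i j x)
| Id_cylC i j : set_identity (TCyl i (TCyl j x)) (TCyl j (TCyl i x)).

Definition universal_closure (t u : pa_term n) : pa_formula n :=
  FAll 0 (FAll 1 (FAll 2 (FEq t u))).

Definition atom_formula : pa_formula n :=
  FAnd (FNot (FEq y (TZero n)))
    (FAll 2 (FOr (FEq (TJoin y z) z) (FEq (TJoin y (TCompl z)) (TCompl z)))).

(** For [i = j] this is atomicity; for [i <> j] it says that the elements
    [s^i_j a], for [a] an atom, have supremum 1, hence that [s^i_j] preserves
    suprema. *)
Definition atoms_cover_formula (i j : 'I_n) : pa_formula n :=
  FAll 0 (FImp (FNot (FEq x (TZero n)))
    (FEx 1 (FAnd atom_formula (FNot (FEq (TMeet x (TSubst i j y)) (TZero n)))))).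

Definition cr_axioms : set (pa_formula n) :=
  [set p | (exists t u, (pa_identity t u \/ set_identity t u)
                          /\ p = universal_closure t u)
        \/ exists i j, p = atoms_cover_formula i j].

Lemma cr_axioms_sentence p : cr_axioms p -> is_sentence p.
Proof.
case=> [[t [u [tu ->]]]|[i [j ->]]] [|[|[|w]]] //.
by case: tu => -[].
Qed.

End Axiomatization.

Definition atoms_cover n (A : pa_structure n) (i j : 'I_n) := forall y : A,
  y <> pa_zero A -> exists2 a, is_atom a & pa_meet y (pa_subst i j a) <> pa_zero A.

Record cr_laws n (A : pa_structure n) : Prop := CRLaws {
  law_PA : is_PA A;
  law_subst_transp : forall (i j : 'I_n) (x : A),
    pa_subst i j (pa_transp i j x) = pa_subst i j x;
  law_cylC : forall (i j : 'I_n) (x : A),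
    pa_cyl i (pa_cyl j x) = pa_cyl j (pa_cyl i x);
  law_atoms_cover : forall i j, atoms_cover A i j
}.

Section Models.
Variables (n : nat) (A : pa_structure n).

Definition env3 (a b c : A) : nat -> A :=
  update (update (update (fun=> a) 0 a) 1 b) 2 c.

Lemma is_PA_of_identities :
  (forall t u, pa_identity t u -> forall a b c,
     eval (env3 a b c) t = eval (env3 a b c) u) -> is_PA A.
Proof.
move=> id; pose o := pa_zero A; split.
- split.
  + exact: (fun a b => id _ _ (Id_joinC n) a b o).
  + exact: (fun a b => id _ _ (Id_meetC n) a b o).
  + exact: (fun a b c => id _ _ (Id_joinA n) a b c).
  + exact: (fun a b c => id _ _ (Id_meetA n) a b c).
  + exact: (fun a b => id _ _ (Id_joinK n) a b o).
  + exact: (fun a b => id _ _ (Id_meetK n) a b o).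
  + exact: (fun a b c => id _ _ (Id_meet_join n) a b c).
  + exact: (fun a b c => id _ _ (Id_join_meet n) a b c).
  + exact: (fun a => id _ _ (Id_join0 n) a o o).
  + exact: (fun a => id _ _ (Id_meet1 n) a o o).
  + exact: (fun a => id _ _ (Id_join_compl n) a o o).
  + exact: (fun a => id _ _ (Id_meet_compl n) a o o).
- exact: (fun i a => id _ _ (Id_subst_id i) a o o).
- exact: (fun i a => id _ _ (Id_transp_id i) a o o).
- exact: (fun i j a => id _ _ (Id_transpC i j) a o o).
- exact: (fun i a => id _ _ (Id_le_cyl i) a o o).
- exact: (fun i a b => id _ _ (Id_cyl_join i) a b o).
- exact: (fun i j a => id _ _ (Id_subst_cyl i j) a o o).
- exact: (fun i j a ij => id _ _ (Id_cyl_subst ij) a o o).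
- exact: (fun i j k a ki kj => id _ _ (Id_subst_cylC ki kj) a o o).
- move=> i j; split.
  + exact: (fun a b => id _ _ (Id_subst_join i j) a b o).
  + exact: (fun a b => id _ _ (Id_subst_meet i j) a b o).
  + exact: (fun a => id _ _ (Id_subst_compl i j) a o o).
  + exact: (id _ _ (Id_subst_zero i j) o o o).
  + exact: (id _ _ (Id_subst_one i j) o o o).
- move=> i j; split.
  + exact: (fun a b => id _ _ (Id_transp_join i j) a b o).
  + exact: (fun a b => id _ _ (Id_transp_meet i j) a b o).
  + exact: (fun a => id _ _ (Id_transp_compl i j) a o o).
  + exact: (id _ _ (Id_transp_zero i j) o o o).
  + exact: (id _ _ (Id_transp_one i j) o o o).
- exact: (fun i j a => id _ _ (Id_transpK i j) a o o).
- exact: (fun i j k a ij ik jk => id _ _ (Id_transp_transp ij ik jk) a o o).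
- exact: (fun i j a => id _ _ (Id_transp_subst i j) a o o).
Qed.

Lemma is_PA_identities t u (v : nat -> A) :
  is_PA A -> pa_identity t u -> eval v t = eval v u.
Proof.
move=> PA; have BA := PA_boolean PA.
have [sh th] := (PA_subst_hom PA, PA_transp_hom PA).
case=> * /=.
- exact: ba_joinC.
- exact: ba_meetC.
- exact: ba_joinA.
- exact: ba_meetA.
- exact: ba_joinK.
- exact: ba_meetK.
- exact: ba_meet_join.
- exact: ba_join_meet.
- exact: ba_join0.
- exact: ba_meet1.
- exact: ba_join_compl.
- exact: ba_meet_compl.
- exact: PA_subst_id.
- exact: PA_transp_id.
- exact: PA_transpC.
- exact: PA_le_cyl.
- exact: PA_cyl_join.
- exact: PA_subst_cyl.
- exact: PA_cyl_subst.
- exact: PA_subst_cylC.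
- exact: (hom_join (sh _ _)).
- exact: (hom_meet (sh _ _)).
- exact: (hom_compl (sh _ _)).
- exact: (hom_zero (sh _ _)).
- exact: (hom_one (sh _ _)).
- exact: (hom_join (th _ _)).
- exact: (hom_meet (th _ _)).
- exact: (hom_compl (th _ _)).
- exact: (hom_zero (th _ _)).
- exact: (hom_one (th _ _)).
- exact: PA_transpK.
- exact: PA_transp_transp.
- exact: PA_transp_subst.
Qed.

Lemma model_cr_axioms : is_model A (@cr_axioms n) <-> cr_laws A.
Proof.
split=> [mod|[PA st cc cov]]; last first.
  move=> p [[t [u [tu ->]]]|[i [j ->]]] v; last first.
    by move=> y /(cov i j y)[a a_at ya]; exists a.
  move=> a b c; case: tu => [/is_PA_identities|[]]; first exact.
  - by move=> i j; apply: st.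
  - by move=> i j; apply: cc.
have id t u (tu : pa_identity t u \/ set_identity t u) (a b c : A) :
    eval (env3 a b c) t = eval (env3 a b c) u.
  by apply: (mod (universal_closure t u)); left; exists t, u.
pose o := pa_zero A; split.
- by apply: is_PA_of_identities => t u tu; apply: id; left.
- exact: (fun i j a => id _ _ (or_intror (Id_subst_transp i j)) a o o).
- exact: (fun i j a => id _ _ (or_intror (Id_cylC i j)) a o o).
- move=> i j y y0.
  have [|a [a_at ya]] := mod (atoms_cover_formula i j) _ (fun=> o) y y0.
    by right; exists i, j.
  by exists a.
Qed.

End Models.

(** * Complete representations satisfy the axioms *)

Section Soundness.
Variables (n : nat) (A : pa_structure n) (K : Type) (U : K -> Type).
Variable h : A -> product_structure (fun k => full_set_algebra n (U k)).
Arguments h : clear implicits.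
Hypotheses (PA : is_PA A) (hrep : is_complete_representation h).

Let BA := PA_boolean PA.
Let hhom : is_homomorphism h := proj1 (proj1 hrep).
Let hinj : injective h := proj2 (proj1 hrep).

Lemma rep_neq0 (x : A) (k : K) (s : 'I_n -> U k) : h x k s -> x <> pa_zero A.
Proof. by move=> hxs x0; move: hxs; rewrite x0 (hom_zero (hom_boolean hhom)). Qed.

Lemma rep_compl (x : A) (k : K) (s : 'I_n -> U k) : h (pa_compl x) k s <-> ~ h x k s.
Proof. by rewrite (hom_compl (hom_boolean hhom)). Qed.

Lemma rep_neq0_point (x : A) : x <> pa_zero A -> exists (k : K) (s : 'I_n -> U k), h x k s.
Proof.
move=> x0; apply: contrapT => none; apply/x0/hinj/functional_extensionality_dep => k.
rewrite (hom_zero (hom_boolean hhom)); apply/seteqP; split=> // s hxs.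
by apply: none; exists k, s.
Qed.

(** The elements containing a point form an ultrafilter. If it had no atom, the
    complements of its members would have supremum 1, although no image of
    such a complement contains the point. *)
Lemma rep_atom (k : K) (s : 'I_n -> U k) : exists2 a, is_atom a & h a k s.
Proof.
apply: contrapT => no_atom.
pose S : set A := [set pa_compl x | x in [set x | h x k s]].
have S1 : is_supremum S (pa_one A).
  split=> [a _|y yub]; first exact: le1.
  have yF x : h x k s -> pa_le (pa_compl y) x.
    by move=> hx; apply: (compl_leC BA); apply: yub; exists x.
  have [y0|y0] := pselect (pa_compl y = pa_zero A).
    by rewrite /pa_le -(ba_join_compl BA y) y0 (ba_join0 BA) (le_refl BA).
  case: no_atom; exists (pa_compl y).
    split=> // w; have [/yF|/rep_compl/yF] := pselect (h w k s); by [left|right].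
  apply/rep_compl => /yF y'y; apply: y0.
  exact: le_disjoint y'y (le_refl BA _).
have := proj2 hrep _ _ S1 k; rewrite (hom_one (hom_boolean hhom)) => /seteqP[+ _].
by move=> /(_ s I)[_ [x hx <-]] /rep_compl.
Qed.

Lemma rep_atoms_cover i j : atoms_cover A i j.
Proof.
move=> y /rep_neq0_point[k [s hy]].
have [a a_at ha] := rep_atom (s \o replacement i j).
exists a => //; apply: (@rep_neq0 _ k s).
by rewrite (hom_meet (hom_boolean hhom)); split=> //; rewrite (hom_subst hhom).
Qed.

Lemma rep_subst_transp i j (x : A) :
  pa_subst i j (pa_transp i j x) = pa_subst i j x.
Proof.
apply: hinj; rewrite !(hom_subst hhom) (hom_transp hhom).
apply/functional_extensionality_dep => k; rewrite /=.
suff E (s : 'I_n -> U k) : (s \o replacement i j) \o tperm i j = s \o replacement i j.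
  by apply/seteqP; split=> s /=; rewrite E.
apply/funext => m /=; rewrite /replacement.
by case: tpermP => [->|->|//]; rewrite eqxx; case: eqP.
Qed.

Lemma set_cylC_sub (V : Type) (i j : 'I_n) (X : full_set_algebra n V) :
  pa_cyl i (pa_cyl j X) `<=` pa_cyl j (pa_cyl i X).
Proof.
move=> s [t [r Xr rt] ts].
exists (fun m => if m == j then r m else s m); last by move=> m /eqP/negbTE ->.
exists r => // m mi; case: eqP => // mj; by rewrite rt // ts.
Qed.

Lemma rep_cylC i j (x : A) : pa_cyl i (pa_cyl j x) = pa_cyl j (pa_cyl i x).
Proof.
apply: hinj; rewrite !(hom_cyl hhom); apply/functional_extensionality_dep => k.
by apply/seteqP; split; apply: set_cylC_sub.
Qed.

Lemma rep_cr_laws : cr_laws A.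
Proof.
split=> //; [exact: rep_subst_transp|exact: rep_cylC|exact: rep_atoms_cover].
Qed.

End Soundness.

(** * The graph of atoms *)

Section Atoms.
Variables (n : nat) (A : pa_structure n).
Hypothesis laws : cr_laws A.

Let PA := law_PA laws.
Let BA := PA_boolean PA.

Lemma exists_atom_le (i : 'I_n) (y : A) :
  y <> pa_zero A -> exists2 a, is_atom a & pa_le a y.
Proof.
case/(law_atoms_cover laws i i) => a a_at; rewrite (PA_subst_id PA) => ya.
by exists a => //; apply: atom_meet.
Qed.

Definition atom := {a : A | is_atom a}.

Definition below (a : atom) (x : A) := pa_le (proj1_sig a) x.

Lemma atom_ext (a b : atom) : (forall x, below a x -> below b x) -> b = a.
Proof.
case: a b => a aP [b bP] ab; apply: eq_exist.
by apply: (atom_le_eq BA) => //; apply: (ab a); apply: (le_refl BA).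
Qed.

(** An atom [b] lies under [s^i_j x] for all [x] in an ultrafilter of the
    algebra; the covering law makes that ultrafilter principal. *)
Lemma exists_shadow (i j : 'I_n) (b : atom) :
  exists a : atom, forall x, below a x <-> below b (pa_subst i j x).
Proof.
have shom := PA_subst_hom PA i j.
case: b => b b_at.
have [a a_at] := law_atoms_cover laws i j (proj1 b_at).
rewrite (ba_meetC BA) => /(atom_meet BA b_at) ba.
exists (exist _ a a_at) => x; rewrite /below /=.
split=> [ax|bx]; first exact: (le_trans BA ba (hom_le shom ax)).
apply: contrapT => /(atom_le_compl BA _ a_at) ax'.
apply: (proj1 b_at); apply: (le_disjoint BA bx).
by rewrite -(hom_compl shom); exact: (le_trans BA ba (hom_le shom ax')).
Qed.

(** In a representation the shadow of the atom of [s] is the atom of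
    [s \o replacement i j]. *)
Definition shadow i j b : atom := sval (cid (exists_shadow i j b)).

Lemma below_shadow i j b x : below (shadow i j b) x <-> below b (pa_subst i j x).
Proof. exact: (svalP (cid (exists_shadow i j b))). Qed.

Lemma shadow_ext i j a b :
  (forall x, below b (pa_subst i j x) -> below a (pa_subst i j x)) ->
  shadow i j a = shadow i j b.
Proof. by move=> ab; apply: atom_ext => x /below_shadow/ab/below_shadow. Qed.

Lemma subst_subst i j (x : A) :
  i <> j -> pa_subst i j (pa_subst i j x) = pa_subst i j x.
Proof. by move=> ij; rewrite -(PA_cyl_subst PA x ij) (PA_subst_cyl PA). Qed.

Lemma shadow_shadow i j b : i <> j -> shadow i j (shadow i j b) = shadow i j b.
Proof.
move=> ij; apply: atom_ext => x bx; do 2 apply/below_shadow.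
by rewrite subst_subst //; apply/below_shadow.
Qed.

Lemma le_cyl2 i (x y : A) : pa_le x y -> pa_le (pa_cyl i x) (pa_cyl i y).
Proof. by rewrite /pa_le -(PA_cyl_join PA) => ->. Qed.

(** The range of [c_i] is that of the endomorphism [s^i_j], hence closed under
    complements. *)
Lemma cyl_compl_cyl i j (x : A) :
  i <> j -> pa_cyl i (pa_compl (pa_cyl i x)) = pa_compl (pa_cyl i x).
Proof.
move=> ij; have shom := PA_subst_hom PA i j.
by rewrite -(PA_subst_cyl PA i j x) -(hom_compl shom) (PA_cyl_subst PA _ ij).
Qed.

(** Since [c_i] is the closure onto the range of [s^i_j], two atoms lie under
    the same [i]-cylinders exactly when their shadows agree. *)
Lemma below_cyl i j b x : i <> j ->
  below b (pa_cyl i x) <-> exists2 a, below a x & shadow i j a = shadow i j b.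
Proof.
move=> ij; split=> [bx|[a ax ab]]; last first.
  rewrite -(PA_subst_cyl PA i j); apply/below_shadow; rewrite -ab.
  apply/below_shadow; rewrite (PA_subst_cyl PA).
  exact: (le_trans BA ax (PA_le_cyl PA i x)).
(* Any atom below [y] will do; [y] is nonzero because [x <= -c_i b] would give
   [b <= c_i x <= -c_i b]. *)
pose y := pa_meet x (pa_cyl i (proj1_sig b)).
have [y0|/(exists_atom_le i)[a a_at ay]] := pselect (y = pa_zero A).
  case: (proj2_sig b) => + _; case; apply: (le_disjoint BA (PA_le_cyl PA i _)).
  apply: (le_trans BA bx).
  rewrite -(cyl_compl_cyl _ ij); apply: le_cyl2; exact: meet0_le_compl.
have [ax ab] := proj1 (le_meetP BA _ _ _) ay.
exists (exist _ a a_at) => //; apply: shadow_ext => z bz.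
apply: (le_trans BA ab); rewrite -(PA_cyl_subst PA _ ij); exact: le_cyl2.
Qed.

Lemma is_atom_transp i j (b : A) : is_atom b -> is_atom (pa_transp i j b).
Proof.
have thom := PA_transp_hom PA i j; move=> [b0 b_dec]; split=> [tb0|x].
  by apply: b0; rewrite -(PA_transpK PA i j b) tb0 (hom_zero thom).
have [bx|bx] := b_dec (pa_transp i j x); [left|right].
  by rewrite -(PA_transpK PA i j x); apply: hom_le.
by rewrite -(PA_transpK PA i j (pa_compl x)); apply: hom_le; rewrite ?(hom_compl thom).
Qed.

Definition transp_atom i j (b : atom) : atom :=
  exist _ _ (is_atom_transp i j (proj2_sig b)).

Lemma below_transp i j b x :
  below (transp_atom i j b) x <-> below b (pa_transp i j x).
Proof.
have thom := PA_transp_hom PA i j.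
split=> bx; first by rewrite /below -(PA_transpK PA i j (sval b)); apply: (hom_le thom bx).
by rewrite /below -(PA_transpK PA i j x); apply: (hom_le thom bx).
Qed.

Lemma shadow_transp i j b : i <> j ->
  shadow i j (transp_atom i j b) = shadow j i b.
Proof.
move=> ij; apply: atom_ext => x /below_shadow bx; apply/below_shadow/below_transp.
by rewrite (PA_transp_subst PA).
Qed.

Lemma transp_shadow i j b : transp_atom i j (shadow i j b) = shadow i j b.
Proof.
apply: atom_ext => x /below_shadow bx; apply/below_transp/below_shadow.
by rewrite (law_subst_transp laws).
Qed.

Lemma transp_atomK i j b : transp_atom i j (transp_atom i j b) = b.
Proof.
by apply: atom_ext => x bx; do 2 apply/below_transp; rewrite (PA_transpK PA).
Qed.

End Atoms.

(** * Building the representation in dimension 2 *)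

Section Completeness.
Variable A : pa_structure 2.
Hypothesis laws : cr_laws A.

Let PA := law_PA laws.
Let BA := PA_boolean PA.

Local Notation i0 := (ord0 : 'I_2).
Local Notation i1 := (ord_max : 'I_2).
Local Notation tgt := (shadow laws i0 i1).
Local Notation rev := (transp_atom laws i0 i1).

Lemma ord2_case (i : 'I_2) : i = i0 \/ i = i1.
Proof. by case: i => [[|[|//]] ?]; [left|right]; apply: val_inj. Qed.

Lemma i01 : i0 <> i1. Proof. by []. Qed.
Lemma i10 : i1 <> i0. Proof. by []. Qed.

(** For composition, [a] lies under [c_0 b] and [b] under [c_1 (src b)], where
    [src b] is the loop at the start of [b]. An atom under [c_0 (src b)] with the
    start of [a] is obtained by exchanging [c_0] and [c_1]. *)
Lemma atom_graph : reversible_graph tgt rev.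
Proof.
split=> [e|e|e|a b ab].
- exact: transp_atomK.
- exact: (shadow_shadow laws _ i01).
- exact: transp_shadow.
have ac : below a (pa_cyl i0 (pa_cyl i1 (sval (tgt (rev b))))).
  apply/(below_cyl laws _ _ i01); exists b => //.
  apply/(below_cyl laws _ _ i10); exists (tgt (rev b)); first exact: (le_refl BA).
  by rewrite -!(shadow_transp laws _ i01) transp_shadow shadow_shadow.
move: ac; rewrite (law_cylC laws) => /(below_cyl laws _ _ i10)[c].
move=> /(below_cyl laws _ _ i01)[d db dc] ca.
exists c; first by rewrite !(shadow_transp laws _ i01).
rewrite -dc; have -> : d = tgt (rev b); last exact: (shadow_shadow laws _ i01).
by apply: (atom_ext laws) => x; apply: (le_trans BA db).
Qed.

(** Atoms in the same component give repeated coordinates, which does no harm and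
    spares a choice of representatives. *)
Let lab_space (k : atom A) := cid (exists_saturated_labelling atom_graph k).
Let U k : Type := sval (lab_space k).
Let lab k : U k -> U k -> atom A := sval (cid (svalP (lab_space k))).

Lemma labP k : saturated_labelling tgt rev (@lab k).
Proof. exact: (proj1 (svalP (cid (svalP (lab_space k))))). Qed.

Lemma lab_root k : exists v, @lab k v v = tgt k.
Proof. exact: (proj2 (svalP (cid (svalP (lab_space k))))). Qed.

Definition label_rep (x : A) :
    product_structure (fun k : atom A => full_set_algebra 2 (U k)) :=
  fun k => [set s | below (lab (s i0) (s i1)) x].
Arguments label_rep : clear implicits.

Lemma label_rep_hom : is_homomorphism label_rep.
Proof.
have ext k (X Y : set ('I_2 -> U k)) : (forall s, X s <-> Y s) -> X = Y.
  by move=> XY; apply/seteqP; split=> s /XY.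
split; [split|..].
- move=> x y; apply/functional_extensionality_dep => k; apply: ext => s.
  exact: (atom_le_join BA _ _ (svalP _)).
- move=> x y; apply/functional_extensionality_dep => k; apply: ext => s.
  exact: (le_meetP BA).
- move=> x; apply/functional_extensionality_dep => k; apply: ext => s.
  exact: (atom_le_compl BA _ (svalP _)).
- apply/functional_extensionality_dep => k; apply: ext => s; split=> // s0.
  exact: (proj1 (svalP (lab (s i0) (s i1))) (le0_eq BA s0)).
- apply/functional_extensionality_dep => k; apply: ext => s; split=> // _.
  exact: (le1 BA).
- move=> i x; apply/functional_extensionality_dep => k; apply: ext => s.
  have L := labP k.
  case: (ord2_case i) => ->; split.
  + move=> /(below_cyl laws _ _ i01)[a ax]; rewrite (lab_tgt L) => /(lab_sat L)[u ua].
    exists (fun m => if m == i0 then u else s i1); first by rewrite /label_rep /= ua.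
    by move=> j j0; case: (ord2_case j) => // ->.
  + case=> t tx ts; apply/(below_cyl laws _ _ i01).
    by exists (lab (t i0) (t i1)) => //; rewrite !(lab_tgt L) ts.
  + move=> /(below_cyl laws _ _ i10)[a ax].
    rewrite -!(shadow_transp laws _ i01) (lab_rev L) (lab_tgt L).
    move=> /(lab_sat L)[u ua].
    exists (fun m => if m == i1 then u else s i0).
      by rewrite /label_rep /= -(lab_rev L) ua transp_atomK.
    by move=> j j1; case: (ord2_case j) => // ->.
  + case=> t tx ts; apply/(below_cyl laws _ _ i10).
    exists (lab (t i0) (t i1)) => //.
    by rewrite -!(shadow_transp laws _ i01) !(lab_rev L) !(lab_tgt L) ts.
- move=> i j x; apply/functional_extensionality_dep => k; apply: ext => s.
  have L := labP k; rewrite /label_rep /= /replacement.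
  case: (ord2_case i) => ->; case: (ord2_case j) => -> /=.
  + by rewrite (PA_subst_id PA).
  + rewrite -(lab_tgt L (s i0)); exact: iff_sym (below_shadow _ _ _ _ _).
  + rewrite -(lab_tgt L (s i1)) -(lab_rev L (s i0)) (shadow_transp laws _ i01).
    exact: iff_sym (below_shadow _ _ _ _ _).
  + by rewrite (PA_subst_id PA).
- move=> i j x; apply/functional_extensionality_dep => k; apply: ext => s.
  have L := labP k; rewrite /label_rep /=.
  have swap : below (lab (s i0) (s i1)) (pa_transp i0 i1 x)
      <-> below (lab (s i1) (s i0)) x.
    rewrite -(lab_rev L (s i0)); exact: iff_sym (below_transp _ _ _ _ _).
  case: (ord2_case i) => ->; case: (ord2_case j) => ->.
  + by rewrite (PA_transp_id PA) tperm1 !perm1.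
  + by rewrite tpermL tpermR.
  + by rewrite (PA_transpC PA) tpermL tpermR.
  + by rewrite (PA_transp_id PA) tperm1 !perm1.
Qed.

(** An atom [k] under [x] but not [y] labels a pair in its own coordinate: by
    saturation, at the point that carries the target of [k]. *)
Lemma label_rep_inj : injective label_rep.
Proof.
have sub x y : label_rep x = label_rep y -> pa_le x y.
  move=> xy; apply: (meet_compl0_le BA); apply: contrapT.
  case/(exists_atom_le laws i0) => a a_at /(le_meetP BA)[ax].
  move=> /(atom_le_compl BA _ a_at); apply.
  have [v vv] := lab_root (exist _ a a_at).
  have [u uv] := lab_sat (labP _) (esym vv).
  have : label_rep x (exist _ a a_at) (fun m => if m == i0 then u else v).
    by rewrite /label_rep /= uv.
  by rewrite xy /label_rep /= uv.
by move=> x y xy; apply: (le_anti BA); apply: sub.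
Qed.

Lemma label_rep_complete : is_complete_representation label_rep.
Proof.
split; first by split; [exact: label_rep_hom|exact: label_rep_inj].
move=> S x Sx k; apply/seteqP; split=> s.
  by case/(atom_le_sup BA (svalP _) Sx) => a Sa la; exists a.
by case=> a Sa la; apply: (le_trans BA la); apply: (proj1 Sx).
Qed.

Lemma cr_laws_completely_representable : completely_representable A.
Proof. by exists (atom A), U, label_rep; exact: label_rep_complete. Qed.

End Completeness.

Theorem theorem2p3 :
  elementary (fun A : pa_structure 2 => is_PA A /\ completely_representable A).
Proof.
exists (@cr_axioms 2); split=> [|A]; first exact: cr_axioms_sentence.
split=> [/model_cr_axioms laws|[PA [K [U [h hrep]]]]].
  by split; [exact: law_PA|exact: cr_laws_completely_representable].
by apply/model_cr_axioms; apply: rep_cr_laws hrep.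
Qed.
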